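(* Let $S,T$ be as in the context and let $n,k\geq 1$ be natural numbers. If $\mathrm{Pr}_T(x)$ is a $\Sigma_1$ provability predicate of $T$ satisfying $\mathbf{E}$, $\mathbf{C}$ and $\mathbf{D3}^n_{n+k}$, then $T\nvdash\mathrm{Con}^{\mathrm{L}}_T$.
   Context: $\mathcal{L}_A=\{0,\mathsf{s},+,\times,\leq\}$ is the language of first-order arithmetic, and ''formula'' means $\mathcal{L}_A$-formula; $\ulcorner\varphi\urcorner$ is the numeral of the Gödel number of $\varphi$. $S$ and $T$ are consistent c.e. extensions of Peano Arithmetic $\mathsf{PA}$ in the language $\mathcal{L}_A$ such that $T$ is stronger than $S$ (every theorem of $S$ is a theorem of $T$; $S=T$ is allowed). A formula $\mathrm{Pr}_T(x)$ is a provability predicate of $T$ if for every formula $\varphi$: $T\vdash\varphi$ if and only if $S\vdash\mathrm{Pr}_T(\ulcorner\varphi\urcorner)$. A $\Sigma_1$ provability predicate is one that is a $\Sigma_1$ formula. $\mathrm{Con}^{\mathrm{L}}_T :\equiv \neg\,\mathrm{Pr}_T(\ulcorner 0=1\urcorner)$. Define $\mathrm{Pr}_T^0(\ulcorner\varphi\urcorner)$ to be $\varphi$ and $\mathrm{Pr}_T^{i+1}(\ulcorner\varphi\urcorner)$ to be $\mathrm{Pr}_T(\ulcorner\mathrm{Pr}_T^i(\ulcorner\varphi\urcorner)\urcorner)$. Conditions on $\mathrm{Pr}_T(x)$: - $\mathbf{E}$: for all formulas $\varphi,\psi$, if $T\vdash\varphi\leftrightarrow\psi$, then $S\vdash\mathrm{Pr}_T(\ulcorner\varphi\urcorner)\leftrightarrow\mathrm{Pr}_T(\ulcorner\psi\urcorner)$.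 - $\mathbf{C}$: $S\vdash\mathrm{Pr}_T(\ulcorner\varphi\urcorner)\land\mathrm{Pr}_T(\ulcorner\psi\urcorner)\to\mathrm{Pr}_T(\ulcorner\varphi\land\psi\urcorner)$ for all formulas $\varphi,\psi$. - $\mathbf{D3}^n_m$: $S\vdash\mathrm{Pr}_T^n(\ulcorner\varphi\urcorner)\to\mathrm{Pr}_T^m(\ulcorner\varphi\urcorner)$ for every formula $\varphi$. *)

(* Defs.v *)
From mathcomp Require Import all_boot.
From mathcomp Require Import zify.

Set Implicit Arguments.
Unset Strict Implicit.
Unset Printing Implicit Defensive.

(* Syntax of L_A = {0, s, +, *, <=} with equality; variables are de Bruijn
   indices, so bound names are quotiented away and [All]/[Ex] bind index 0. *)

Inductive term : Type :=
| Var of nat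
| Zero
| Succ of term
| Add of term & term
| Mul of term & term.

Inductive form : Type :=
| Bot
| Eq of term & term
| Le of term & term
| Imp of form & form
| And of form & form
| Or of form & form
| All of form
| Ex of form.

Definition Neg (f : form) : form := Imp f Bot.
Definition Iff (f g : form) : form := And (Imp f g) (Imp g f).

Fixpoint numeral (n : nat) : term :=
  if n is m.+1 then Succ (numeral m) else Zero.

Fixpoint subst_term (s : nat -> term) (t : term) : term :=
  match t with
  | Var i => s i
  | Zero => Zero
  | Succ t1 => Succ (subst_term s t1)
  | Add t1 t2 => Add (subst_term s t1) (subst_term s t2)
  | Mul t1 t2 => Mul (subst_term s t1) (subst_term s t2)
  end.

Definition shift_term : term -> term := subst_term (fun i => Var i.+1).

Definition up (s : nat -> term) (i : nat) : term :=
  if i is j.+1 then shift_term (s j) else Var 0.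

Fixpoint subst (s : nat -> term) (f : form) : form :=
  match f with
  | Bot => Bot
  | Eq t u => Eq (subst_term s t) (subst_term s u)
  | Le t u => Le (subst_term s t) (subst_term s u)
  | Imp g h => Imp (subst s g) (subst s h)
  | And g h => And (subst s g) (subst s h)
  | Or g h => Or (subst s g) (subst s h)
  | All g => All (subst (up s) g)
  | Ex g => Ex (subst (up s) g)
  end.

Definition shift : form -> form := subst (fun i => Var i.+1).

(* Replaces index 0 by [t] and lowers the other free indices by one. *)
Definition inst (f : form) (t : term) : form :=
  subst (fun i => if i is j.+1 then Var j else t) f.

(* [closed_at n f]: every free index of [f] is below [n]. *)
Fixpoint term_closed_at (n : nat) (t : term) : bool :=
  match t with
  | Var i => i < n
  | Zero => true
  | Succ t1 => term_closed_at n t1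
  | Add t1 t2 | Mul t1 t2 => term_closed_at n t1 && term_closed_at n t2
  end.

Fixpoint closed_at (n : nat) (f : form) : bool :=
  match f with
  | Bot => true
  | Eq t u | Le t u => term_closed_at n t && term_closed_at n u
  | Imp g h | And g h | Or g h => closed_at n g && closed_at n h
  | All g | Ex g => closed_at n.+1 g
  end.

Definition sentence (f : form) : Prop := closed_at 0 f.

(* Classical natural deduction with equality; the shifts of the context
   express the eigenvariable conditions. *)

Inductive nd : seq form -> form -> Prop :=
| nd_ax G f : List.In f G -> nd G f
| nd_raa G f : nd (Neg f :: G) Bot -> nd G f
| nd_impI G f g : nd (f :: G) g -> nd G (Imp f g)
| nd_impE G f g : nd G (Imp f g) -> nd G f -> nd G g
| nd_andI G f g : nd G f -> nd G g -> nd G (And f g)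
| nd_andE1 G f g : nd G (And f g) -> nd G f
| nd_andE2 G f g : nd G (And f g) -> nd G g
| nd_orI1 G f g : nd G f -> nd G (Or f g)
| nd_orI2 G f g : nd G g -> nd G (Or f g)
| nd_orE G f g h : nd G (Or f g) -> nd (f :: G) h -> nd (g :: G) h -> nd G h
| nd_allI G f : nd (map shift G) f -> nd G (All f)
| nd_allE G f t : nd G (All f) -> nd G (inst f t)
| nd_exI G f t : nd G (inst f t) -> nd G (Ex f)
| nd_exE G f g : nd G (Ex f) -> nd (f :: map shift G) (shift g) -> nd G g
| nd_refl G t : nd G (Eq t t)
| nd_leibniz G f t u : nd G (Eq t u) -> nd G (inst f t) -> nd G (inst f u).

(* A theory is given by a set of axioms, required to be sentences; then an
   open formula is provable iff its universal closure is. *)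

Definition theory : Type := form -> Prop.

Definition is_theory (T : theory) : Prop := forall f, T f -> sentence f.

Definition provable (T : theory) (f : form) : Prop :=
  exists G : seq form, (forall g, List.In g G -> T g) /\ nd G f.

Definition consistent (T : theory) : Prop := ~ provable T Bot.

Definition extends (T S : theory) : Prop :=
  forall f, provable S f -> provable T f.

(* f(0) /\ forall x (f(x) -> f(s x)) -> forall x f(x), where x is index 0. *)
Definition induction (f : form) : form :=
  Imp (And (inst f Zero)
           (All (Imp f (subst (fun i => if i is 0 then Succ (Var 0) else Var i)
                              f))))
      (All f).

Inductive PA : theory :=
| PA_succ0 : PA (All (Neg (Eq (Succ (Var 0)) Zero)))
| PA_succ_inj :
    PA (All (All (Imp (Eq (Succ (Var 1)) (Succ (Var 0)))
                      (Eq (Var 1) (Var 0)))))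
| PA_add0 : PA (All (Eq (Add (Var 0) Zero) (Var 0)))
| PA_addS :
    PA (All (All (Eq (Add (Var 1) (Succ (Var 0)))
                     (Succ (Add (Var 1) (Var 0))))))
| PA_mul0 : PA (All (Eq (Mul (Var 0) Zero) Zero))
| PA_mulS :
    PA (All (All (Eq (Mul (Var 1) (Succ (Var 0)))
                     (Add (Mul (Var 1) (Var 0)) (Var 1)))))
| PA_le :
    PA (All (All (Iff (Le (Var 1) (Var 0))
                      (Ex (Eq (Add (Var 0) (Var 2)) (Var 1))))))
| PA_induction (f : form) (n : nat) :
    closed_at n (induction f) -> PA (iter n All (induction f)).

(* In the bounded quantifiers the bound [t] lives outside the binder, so it
   cannot contain the quantified variable. *)
Inductive Delta0 : form -> Prop :=
| D0_bot : Delta0 Bot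
| D0_eq t u : Delta0 (Eq t u)
| D0_le t u : Delta0 (Le t u)
| D0_imp f g : Delta0 f -> Delta0 g -> Delta0 (Imp f g)
| D0_and f g : Delta0 f -> Delta0 g -> Delta0 (And f g)
| D0_or f g : Delta0 f -> Delta0 g -> Delta0 (Or f g)
| D0_all t f : Delta0 f -> Delta0 (All (Imp (Le (Var 0) (shift_term t)) f))
| D0_ex t f : Delta0 f -> Delta0 (Ex (And (Le (Var 0) (shift_term t)) f)).

Inductive Sigma1 : form -> Prop :=
| S1_delta0 f : Delta0 f -> Sigma1 f
| S1_ex f : Sigma1 f -> Sigma1 (Ex f).

(* Goedel numbering. The pairing is injective since
   (a+b)^2 <= (a+b)^2 + b < (a+b+1)^2. *)

Definition cpair (a b : nat) : nat := (a + b) ^ 2 + b.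
Arguments cpair : simpl never.

(* Every term is uniquely s^k(u) with u not a successor; [tcode] computes k
   and the code of u, so that successors are coded by their number. *)
Fixpoint tcode (t : term) : nat * nat :=
  match t with
  | Zero => (0, cpair 0 0)
  | Var i => (0, cpair 1 i)
  | Succ t1 => ((tcode t1).1.+1, (tcode t1).2)
  | Add t1 t2 =>
      (0, cpair 2 (cpair (cpair (tcode t1).1 (tcode t1).2)
                         (cpair (tcode t2).1 (tcode t2).2)))
  | Mul t1 t2 =>
      (0, cpair 3 (cpair (cpair (tcode t1).1 (tcode t1).2)
                         (cpair (tcode t2).1 (tcode t2).2)))
  end.

Definition gnt (t : term) : nat := cpair (tcode t).1 (tcode t).2.

Fixpoint gn (f : form) : nat :=
  match f with
  | Bot => cpair 0 0
  | Eq t u => cpair 1 (cpair (gnt t) (gnt u))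
  | Le t u => cpair 2 (cpair (gnt t) (gnt u))
  | Imp g h => cpair 3 (cpair (gn g) (gn h))
  | And g h => cpair 4 (cpair (gn g) (gn h))
  | Or g h => cpair 5 (cpair (gn g) (gn h))
  | All g => cpair 6 (gn g)
  | Ex g => cpair 7 (gn g)
  end.

Lemma cpair_inj a b c d : cpair a b = cpair c d -> a = c /\ b = d.
Proof.
rewrite /cpair => E.
have Es : a + b = c + d by nia.
by rewrite Es in E; lia.
Qed.

Lemma gnt_inj : injective gnt.
Proof.
have tcode_inj : injective tcode.
  elim=> [i||t IH|t1 IH1 t2 IH2|t1 IH1 t2 IH2] [j||u|u1 u2|u1 u2] //= /pair_eqP /andP [/eqP + /eqP] //=.
  all: try by move=> _ /cpair_inj [].
  - by move=> _ /cpair_inj [_ ->].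
  - by move=> [E1] E2; congr Succ; apply: IH; apply/injective_projections.
  - move=> _ /cpair_inj [_] /cpair_inj [/cpair_inj [? ?] /cpair_inj [? ?]].
    by congr Add; [apply: IH1|apply: IH2]; apply/injective_projections.
  - move=> _ /cpair_inj [_] /cpair_inj [/cpair_inj [? ?] /cpair_inj [? ?]].
    by congr Mul; [apply: IH1|apply: IH2]; apply/injective_projections.
by move=> t u /cpair_inj [? ?]; apply/tcode_inj/injective_projections.
Qed.

Lemma gn_inj : injective gn.
Proof.
elim=> [|t u|t u|f1 IH1 f2 IH2|f1 IH1 f2 IH2|f1 IH1 f2 IH2|f1 IH1|f1 IH1]
  [|t' u'|t' u'|g1 g2|g1 g2|g1 g2|g1|g1] //= /cpair_inj [] //= _.
- by move=> /cpair_inj [/gnt_inj -> /gnt_inj ->].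
- by move=> /cpair_inj [/gnt_inj -> /gnt_inj ->].
- by move=> /cpair_inj [/IH1 -> /IH2 ->].
- by move=> /cpair_inj [/IH1 -> /IH2 ->].
- by move=> /cpair_inj [/IH1 -> /IH2 ->].
- by move=> /IH1 ->.
- by move=> /IH1 ->.
Qed.

(* Partial recursive functions (Kleene), with relational semantics:
   [reval f v y] says that f is defined on the arguments v, with value y. *)

Inductive rcode : Type :=
| RZero
| RSucc
| RProj of nat
| RComp of rcode & seq rcode
| RRec of rcode & rcode
| RMin of rcode.

Inductive reval : rcode -> seq nat -> nat -> Prop :=
| ev_zero v : reval RZero v 0
| ev_succ x v : reval RSucc (x :: v) x.+1
| ev_proj i v : i < size v -> reval (RProj i) v (nth 0 v i)
| ev_comp f gs v w y : revals gs v w -> reval f w y -> reval (RComp f gs) v y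
| ev_rec0 f g v y : reval f v y -> reval (RRec f g) (0 :: v) y
| ev_recS f g x v z y :
    reval (RRec f g) (x :: v) z -> reval g (x :: z :: v) y ->
    reval (RRec f g) (x.+1 :: v) y
| ev_min f v y :
    reval f (y :: v) 0 ->
    (forall i, i < y -> exists m, reval f (i :: v) m.+1) ->
    reval (RMin f) v y
with revals : seq rcode -> seq nat -> seq nat -> Prop :=
| evs_nil v : revals [::] v [::]
| evs_cons g gs v y w :
    reval g v y -> revals gs v w -> revals (g :: gs) v (y :: w).

Definition ce (A : nat -> Prop) : Prop :=
  exists f : rcode, forall x, A x <-> exists y, reval f [:: x] y.

Definition ce_theory (T : theory) : Prop :=
  ce (fun x => exists f, x = gn f /\ provable T f).

(* [app P f] is P(<f>): the variable x of P(x) is index 0. *)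
Definition app (P f : form) : form := inst P (numeral (gn f)).

Definition provability_predicate (S T : theory) (P : form) : Prop :=
  closed_at 1 P /\ forall f, provable T f <-> provable S (app P f).

Definition ConL (P : form) : form := Neg (app P (Eq Zero (Succ Zero))).

Definition app_iter (P : form) (i : nat) (f : form) : form := iter i (app P) f.

Definition cond_E (S T : theory) (P : form) : Prop :=
  forall f g, provable T (Iff f g) -> provable S (Iff (app P f) (app P g)).

Definition cond_C (S : theory) (P : form) : Prop :=
  forall f g, provable S (Imp (And (app P f) (app P g)) (app P (And f g))).

Definition cond_D3 (S : theory) (P : form) (n m : nat) : Prop :=
  forall f, provable S (Imp (app_iter P n f) (app_iter P m f)).

(* Main.v *)
Require Import Defs.
From mathcomp Require Import all_boot.

Set Implicit Arguments.
Unset Strict Implicit.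
Unset Printing Implicit Defensive.

(** Write [] for provability and suppose T proves ~ [] (0 = 1).  By E and C,
    whenever T refutes X /\ Y it also refutes [] X /\ [] Y.  Put m = n * k and
    take B with T |- B <-> ~ []^m B.  Starting from ~ (B /\ []^m B), n steps
    give ~ ([]^n B /\ []^(n+m) B), while n uses of D3 give
    []^n B -> []^(n+m) B.  Hence T refutes []^n B, and then, by E, also
    []^m B, because m >= n.  So T proves B, hence []^m B: a contradiction.

    The diagonal lemma needs no arithmetization of syntax: numerals are coded
    by their value, so the code of P(s^N 0) is a polynomial in N and is
    therefore computed by a term of L_A. *)

(** * Substitution *)

Lemma eq_subst_term s s' t : s =1 s' -> subst_term s t = subst_term s' t.
Proof.
move=> e; elim: t => //= [t ->|t -> u ->|t -> u ->] //.
Qed.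

Lemma subst_term_comp s s' t :
  subst_term s (subst_term s' t) = subst_term (subst_term s \o s') t.
Proof. by elim: t => //= [t ->|t -> u ->|t -> u ->]. Qed.

Lemma eq_up s s' : s =1 s' -> up s =1 up s'.
Proof. by move=> e [|i] //=; rewrite e. Qed.

Lemma eq_subst s s' f : s =1 s' -> subst s f = subst s' f.
Proof.
elim: f s s' => //=
  [t u|t u|f IHf g IHg|f IHf g IHg|f IHf g IHg|f IHf|f IHf] s s' e;
  rewrite ?(eq_subst_term _ e) ?(IHf s s') ?(IHg s s') //.
all: by rewrite (IHf _ (up s')) //; apply: eq_up.
Qed.

Lemma up_comp s s' : subst_term (up s) \o up s' =1 up (subst_term s \o s').
Proof. by case=> [|i] //=; rewrite /shift_term !subst_term_comp. Qed.

Lemma subst_comp s s' f :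
  subst s (subst s' f) = subst (subst_term s \o s') f.
Proof.
elim: f s s' => //=
  [t u|t u|f IHf g IHg|f IHf g IHg|f IHf g IHg|f IHf|f IHf] s s';
  rewrite ?subst_term_comp ?IHf ?IHg //.
all: by rewrite (eq_subst _ (up_comp _ _)).
Qed.

Lemma subst_term_var t : subst_term Var t = t.
Proof. by elim: t => //= [t ->|t -> u ->|t -> u ->]. Qed.

Lemma inst_shift_term t u :
  subst_term (fun i => if i is j.+1 then Var j else u) (shift_term t) = t.
Proof. by rewrite /shift_term subst_term_comp -[RHS]subst_term_var. Qed.

Lemma subst_numeral s n : subst_term s (numeral n) = numeral n.
Proof. by elim: n => //= n ->. Qed.

Lemma eq_closed_subst_term n s s' t : term_closed_at n t ->
  (forall i, i < n -> s i = s' i) -> subst_term s t = subst_term s' t.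
Proof.
move=> + e; elim: t => //= [t IHt /IHt -> //|t IHt u IHu|t IHt u IHu].
all: by move=> /andP[/IHt -> /IHu ->].
Qed.

Lemma eq_closed_subst n s s' f : closed_at n f ->
  (forall i, i < n -> s i = s' i) -> subst s f = subst s' f.
Proof.
elim: f n s s' => //=
  [t u|t u|f IHf g IHg|f IHf g IHg|f IHf g IHg|f IHf|f IHf] n s s'.
1,2: by move=> /andP[ct cu] e; rewrite !(eq_closed_subst_term _ e).
1-3: by move=> /andP[cf cg] e; rewrite (IHf _ _ _ cf e) (IHg _ _ _ cg e).
all: by move=> cf e; rewrite (IHf _ _ (up s') cf) // => -[|i] //= /e ->.
Qed.

Lemma term_closed_subst n s t :
  (forall i, term_closed_at n (s i)) -> term_closed_at n (subst_term s t).
Proof. by move=> c; elim: t => //= t -> u ->. Qed.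

Lemma closed_subst n s f :
  (forall i, term_closed_at n (s i)) -> closed_at n (subst s f).
Proof.
elim: f n s => //=
  [t u|t u|f IHf g IHg|f IHf g IHg|f IHf g IHg|f IHf|f IHf] n s c;
  rewrite ?term_closed_subst ?IHf ?IHg //.
all: case=> [|i] //=; elim: (s i) (c i) => //= t IHt u IHu.
all: by move=> /andP[/IHt -> /IHu ->].
Qed.

(* In a formula whose only free variable is index 0, [inst] may as well replace
   every variable; such substitutions compose without index arithmetic. *)
Lemma inst_closed1 F t : closed_at 1 F -> inst F t = subst (fun=> t) F.
Proof. by move=> cF; apply: (eq_closed_subst cF) => -[]. Qed.

(** * Derived rules *)

Lemma in_map_shift G G' : (forall g, List.In g G -> List.In g G') ->
  forall g, List.In g (map shift G) -> List.In g (map shift G').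
Proof.
by move=> sub g /List.in_map_iff[h [<- /sub]]; apply: List.in_map.
Qed.

(** Inclusion by membership survives the shift of the context in the quantifier rules, so the
    induction works for every larger context. *)
Lemma nd_weaken G G' f :
  nd G f -> (forall g, List.In g G -> List.In g G') -> nd G' f.
Proof.
have cons_sub (h : form) (H H' : seq form) :
    (forall g, List.In g H -> List.In g H') ->
    forall g, List.In g (h :: H) -> List.In g (h :: H').
  by move=> sub g /= [->|/sub]; [left|right].
move=> d; elim: d G' => {G f}.
- by move=> G f Gf G' sub; apply/nd_ax/sub.
- by move=> G f _ IH G' sub; apply/nd_raa/IH/cons_sub.
- by move=> G f g _ IH G' sub; apply/nd_impI/IH/cons_sub.
- by move=> G f g _ IH1 _ IH2 G' sub; apply: nd_impE (IH1 _ sub) (IH2 _ sub).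
- by move=> G f g _ IH1 _ IH2 G' sub; apply: nd_andI (IH1 _ sub) (IH2 _ sub).
- by move=> G f g _ IH G' sub; apply: nd_andE1 (IH _ sub).
- by move=> G f g _ IH G' sub; apply: nd_andE2 (IH _ sub).
- by move=> G f g _ IH G' sub; apply: nd_orI1 (IH _ sub).
- by move=> G f g _ IH G' sub; apply: nd_orI2 (IH _ sub).
- move=> G f g h _ IH1 _ IH2 _ IH3 G' sub.
  by apply: nd_orE (IH1 _ sub) (IH2 _ _) (IH3 _ _); apply: cons_sub.
- by move=> G f _ IH G' sub; apply/nd_allI/IH/in_map_shift.
- by move=> G f t _ IH G' sub; apply: nd_allE (IH _ sub).
- by move=> G f t _ IH G' sub; apply: nd_exI (IH _ sub).
- move=> G f g _ IH1 _ IH2 G' sub.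
  by apply: nd_exE (IH1 _ sub) (IH2 _ _); apply/cons_sub/in_map_shift.
- by move=> G t G' sub; apply: nd_refl.
- by move=> G f t u _ IH1 _ IH2 G' sub;
  apply: nd_leibniz (IH1 _ sub) (IH2 _ sub).
Qed.

Lemma provable_impE T f g :
  provable T (Imp f g) -> provable T f -> provable T g.
Proof.
move=> [G [TG dG]] [H [TH dH]]; exists (G ++ H); split.
  by move=> h /(List.in_app_or G H) [/TG|/TH].
by apply: (@nd_impE _ f); [apply: nd_weaken dG _|apply: nd_weaken dH _] => h ?;
  apply: List.in_or_app; [left|right].
Qed.

(** The hypotheses are discharged one at a time into implications; rules for [provable] then reduce
    to derivations from short contexts. *)
Lemma provable_nd T G f :
  nd G f -> (forall g, List.In g G -> provable T g) -> provable T f.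
Proof.
elim: G f => [|a G IH] f d TG; first by exists [::].
apply: (@provable_impE _ a); last by apply: TG; left.
by apply: IH => [|g Gg]; [apply: nd_impI|apply: TG; right].
Qed.

Lemma provable_nd1 T a f : nd [:: a] f -> provable T a -> provable T f.
Proof. by move=> d Ta; apply: provable_nd d _ => g /= [<-|]. Qed.

Lemma provable_nd2 T a b f :
  nd [:: a; b] f -> provable T a -> provable T b -> provable T f.
Proof. by move=> d Ta Tb; apply: provable_nd d _ => g /= [<-|[<-|]]. Qed.

Ltac assumption_nd := by apply: nd_ax; rewrite /=; intuition.

Lemma provable_iffP T f g :
  provable T (Iff f g) <-> provable T (Imp f g) /\ provable T (Imp g f).
Proof.
split=> [h|[h1 h2]].
  by split; apply: provable_nd1 h; [apply: nd_andE1|apply: nd_andE2];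
    assumption_nd.
by apply: provable_nd2 h1 h2; apply: nd_andI; assumption_nd.
Qed.

Lemma provable_imp_trans T f g h :
  provable T (Imp f g) -> provable T (Imp g h) -> provable T (Imp f h).
Proof.
apply: provable_nd2; apply/nd_impI/(@nd_impE _ g); first by assumption_nd.
by apply: (@nd_impE _ f); assumption_nd.
Qed.

Lemma provable_imp_refl T f : provable T (Imp f f).
Proof. by exists [::]; split=> //; apply: nd_impI; assumption_nd. Qed.

Lemma provable_contrapose T f g :
  provable T (Imp f g) -> provable T (Imp (Neg g) (Neg f)).
Proof.
apply: provable_nd1; do 2!apply: nd_impI.
apply: (@nd_impE _ g); first by assumption_nd.
by apply: (@nd_impE _ f); assumption_nd.
Qed.

(** Turns a refutation into the kind of equivalence to which E applies. *)
Lemma provable_neg_iff T f : provable T (Neg f) -> provable T (Iff f Bot).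
Proof.
move=> h; apply/provable_iffP; split=> //.
exists [::]; split=> //; apply/nd_impI/nd_raa; assumption_nd.
Qed.

Lemma provable_imp_and T f g h : provable T (Imp f g) ->
  provable T (Imp (And f g) h) -> provable T (Imp f h).
Proof.
apply: provable_nd2; apply/nd_impI/(@nd_impE _ (And f g)).
  by assumption_nd.
apply: nd_andI; first by assumption_nd.
by apply: (@nd_impE _ f); assumption_nd.
Qed.

(** * Evaluation of closed terms in PA *)

Lemma provable_leibniz T f t u :
  provable T (Eq t u) -> provable T (inst f t) -> provable T (inst f u).
Proof. by apply: provable_nd2; apply: nd_leibniz; assumption_nd. Qed.

Lemma provable_refl T t : provable T (Eq t t).
Proof. by exists [::]; split=> //; apply: nd_refl. Qed.

Lemma provable_allE T f t : provable T (All f) -> provable T (inst f t).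
Proof. by apply: provable_nd1; apply: nd_allE; assumption_nd. Qed.

(** Leibniz for the formula x = t, with [t] shifted past x so that instantiation fixes it;
    transitivity and congruence below use the same device. *)
Lemma nd_eq_sym G t u : nd G (Eq t u) -> nd G (Eq u t).
Proof.
move=> d; have := @nd_leibniz G (Eq (Var 0) (shift_term t)) t u d.
by rewrite /inst /= !inst_shift_term; apply; apply: nd_refl.
Qed.

Lemma provable_sym T t u : provable T (Eq t u) -> provable T (Eq u t).
Proof. by apply: provable_nd1; apply: nd_eq_sym; assumption_nd. Qed.

Lemma provable_trans T t u v :
  provable T (Eq t u) -> provable T (Eq u v) -> provable T (Eq t v).
Proof.
move=> tu uv; have := @provable_leibniz T (Eq (shift_term t) (Var 0)) u v uv.
by rewrite /inst /= !inst_shift_term; apply.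
Qed.

Lemma provable_congS T t u :
  provable T (Eq t u) -> provable T (Eq (Succ t) (Succ u)).
Proof.
move=> tu.
have := @provable_leibniz T (Eq (Succ (shift_term t)) (Succ (Var 0))) t u tu.
by rewrite /inst /= !inst_shift_term; apply; apply: provable_refl.
Qed.

Lemma provable_congA T t u t' u' : provable T (Eq t u) ->
  provable T (Eq t' u') -> provable T (Eq (Add t t') (Add u u')).
Proof.
move=> e e'; apply: (@provable_trans _ _ (Add u t')).
  have := @provable_leibniz T
    (Eq (shift_term (Add t t')) (Add (Var 0) (shift_term t'))) t u e.
  by rewrite /inst [subst _ _]/= [subst _ (Eq _ (Add _ _))]/= !inst_shift_term;
    apply; apply: provable_refl.
have := @provable_leibniz T
  (Eq (shift_term (Add u t')) (Add (shift_term u) (Var 0))) t' u' e'.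
by rewrite /inst [subst _ _]/= [subst _ (Eq _ (Add _ _))]/= !inst_shift_term;
  apply; apply: provable_refl.
Qed.

Lemma provable_congM T t u t' u' : provable T (Eq t u) ->
  provable T (Eq t' u') -> provable T (Eq (Mul t t') (Mul u u')).
Proof.
move=> e e'; apply: (@provable_trans _ _ (Mul u t')).
  have := @provable_leibniz T
    (Eq (shift_term (Mul t t')) (Mul (Var 0) (shift_term t'))) t u e.
  by rewrite /inst [subst _ _]/= [subst _ (Eq _ (Mul _ _))]/= !inst_shift_term;
    apply; apply: provable_refl.
have := @provable_leibniz T
  (Eq (shift_term (Mul u t')) (Mul (shift_term u) (Var 0))) t' u' e'.
by rewrite /inst [subst _ _]/= [subst _ (Eq _ (Mul _ _))]/= !inst_shift_term;
  apply; apply: provable_refl.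
Qed.

Lemma provable_axiom (T : theory) f : T f -> provable T f.
Proof.
by move=> Tf; exists [:: f]; split=> [g /= [<-|]|] //; assumption_nd.
Qed.

Lemma PA_add_numeral a b :
  provable PA (Eq (Add (numeral a) (numeral b)) (numeral (a + b))).
Proof.
elim: b => [|b IH].
  by rewrite addn0; apply: (provable_allE (numeral a) (provable_axiom PA_add0)).
have := provable_allE (numeral a) (provable_axiom PA_addS).
rewrite {1}/inst [subst _ _]/= => /(provable_allE (numeral b)).
rewrite /inst /= /shift_term !subst_numeral addnS => h.
exact: provable_trans h (provable_congS IH).
Qed.

Lemma PA_mul_numeral a b :
  provable PA (Eq (Mul (numeral a) (numeral b)) (numeral (a * b))).
Proof.
elim: b => [|b IH].
  by rewrite muln0; apply: (provable_allE (numeral a) (provable_axiom PA_mul0)).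
have := provable_allE (numeral a) (provable_axiom PA_mulS).
rewrite {1}/inst [subst _ _]/= => /(provable_allE (numeral b)).
rewrite /inst /= /shift_term !subst_numeral mulnS addnC => h.
apply: provable_trans h _; apply: provable_trans (PA_add_numeral _ _).
exact: provable_congA IH (provable_refl _ _).
Qed.

(** All variables share the value [N], matching the substitutions [fun=> numeral N]: a term is read
    as a polynomial in one unknown. *)
Fixpoint teval (N : nat) (t : term) : nat :=
  match t with
  | Var _ => N
  | Zero => 0
  | Succ t1 => (teval N t1).+1
  | Add t1 t2 => teval N t1 + teval N t2
  | Mul t1 t2 => teval N t1 * teval N t2
  end.

Lemma PA_teval N t :
  provable PA (Eq (subst_term (fun=> numeral N) t) (numeral (teval N t))).
Proof.
elim: t => [i||t IHt|t IHt u IHu|t IHt u IHu] /=.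
- exact: provable_refl.
- exact: provable_refl.
- exact: provable_congS.
- exact: provable_trans (provable_congA IHt IHu) (PA_add_numeral _ _).
- exact: provable_trans (provable_congM IHt IHu) (PA_mul_numeral _ _).
Qed.

Lemma teval_numeral N n : teval N (numeral n) = n.
Proof. by elim: n => //= n ->. Qed.

Lemma teval_comp N t u : teval N (subst_term (fun=> u) t) = teval (teval N u) t.
Proof. by elim: t => //= [t ->|t -> v ->|t -> v ->]. Qed.

(** Trades a closed term for the numeral of its value, the form in which [app] refers to codes. *)
Lemma PA_subst_teval F N t : closed_at 1 F ->
  provable PA (Iff (subst (fun=> subst_term (fun=> numeral N) t) F)
                   (inst F (numeral (teval N t)))).
Proof.
move=> cF; rewrite -inst_closed1 //; have e := PA_teval N t.
apply/provable_iffP; split.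
  by apply: provable_nd1 e; apply: nd_impI; apply: nd_leibniz; assumption_nd.
by apply: provable_nd1 (provable_sym e); apply: nd_impI;
  apply: nd_leibniz; assumption_nd.
Qed.

(** * Terms computing Goedel numbers *)

Definition tpair (a b : term) : term := Add (Mul (Add a b) (Add a b)) b.

Lemma teval_pair N a b : teval N (tpair a b) = cpair (teval N a) (teval N b).
Proof. by []. Qed.

(** The successors of a numeral enter its code only as a count, which makes the code a polynomial in
    [n]. *)
Lemma tcode_numeral n : tcode (numeral n) = (n, cpair 0 0).
Proof. by elim: n => //= n ->. Qed.

(** A family of substitutions indexed by [N]. Numerals being closed, the class is stable under
    passing a binder. *)
Definition constant_or_numeral (s : nat -> nat -> term) : Prop :=
  forall i, (forall N, s N i = numeral N) \/ (exists u, forall N, s N i = u).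

Lemma constant_or_numeral_up s :
  constant_or_numeral s -> constant_or_numeral (fun N => up (s N)).
Proof.
move=> cs [|i] /=; first by right; exists (Var 0).
have [e|[u e]] := cs i; [left|right; exists (shift_term u)] => N; rewrite e //.
exact: subst_numeral.
Qed.

(** A variable replaced by the numeral of [N] has code components [N] and a constant, the values of
    [Var 0] and of a numeral; the other constructors act on codes by successor and pairing, which
    are polynomial. *)
Lemma tcode_subst_teval s t : constant_or_numeral s ->
  exists ab : term * term, forall N,
    tcode (subst_term (s N) t) = (teval N ab.1, teval N ab.2).
Proof.
move=> cs.
elim: t => [i||t [ab IH]|t [ab IHt] u [cd IHu]|t [ab IHt] u [cd IHu]] /=.
- have [e|[u e]] := cs i.
    exists (Var 0, numeral (cpair 0 0)) => N.
    by rewrite e tcode_numeral teval_numeral.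
  exists (numeral (tcode u).1, numeral (tcode u).2) => N.
  by rewrite e !teval_numeral; case: tcode.
- by exists (Zero, numeral (cpair 0 0)) => N; rewrite teval_numeral.
- by exists (Succ ab.1, ab.2) => N; rewrite IH.
- exists (Zero, tpair (numeral 2) (tpair (tpair ab.1 ab.2) (tpair cd.1 cd.2))).
  by move=> N; rewrite IHt IHu.
- exists (Zero, tpair (numeral 3) (tpair (tpair ab.1 ab.2) (tpair cd.1 cd.2))).
  by move=> N; rewrite IHt IHu.
Qed.

Lemma gnt_subst_teval s t : constant_or_numeral s ->
  exists c, forall N, gnt (subst_term (s N) t) = teval N c.
Proof.
move=> cs; have [ab e] := tcode_subst_teval t cs.
by exists (tpair ab.1 ab.2) => N; rewrite /gnt e.
Qed.

Lemma gn_subst_teval s f : constant_or_numeral s ->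
  exists c, forall N, gn (subst (s N) f) = teval N c.
Proof.
elim: f s => [|t u|t u|f IHf g IHg|f IHf g IHg|f IHf g IHg|f IHf|f IHf] s cs.
- by exists (numeral (gn Bot)) => N; rewrite teval_numeral.
- have [[c ec] [d ed]] := (gnt_subst_teval t cs, gnt_subst_teval u cs).
  by exists (tpair (numeral 1) (tpair c d)) => N; rewrite /= ec ed.
- have [[c ec] [d ed]] := (gnt_subst_teval t cs, gnt_subst_teval u cs).
  by exists (tpair (numeral 2) (tpair c d)) => N; rewrite /= ec ed.
- have [[c ec] [d ed]] := (IHf _ cs, IHg _ cs).
  by exists (tpair (numeral 3) (tpair c d)) => N; rewrite /= ec ed.
- have [[c ec] [d ed]] := (IHf _ cs, IHg _ cs).
  by exists (tpair (numeral 4) (tpair c d)) => N; rewrite /= ec ed.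
- have [[c ec] [d ed]] := (IHf _ cs, IHg _ cs).
  by exists (tpair (numeral 5) (tpair c d)) => N; rewrite /= ec ed.
- have [c ec] := IHf _ (constant_or_numeral_up cs).
  by exists (tpair (numeral 6) c) => N; rewrite /= ec.
- have [c ec] := IHf _ (constant_or_numeral_up cs).
  by exists (tpair (numeral 7) c) => N; rewrite /= ec.
Qed.

Lemma gn_app_iter_teval P m :
  exists t, forall f, gn (app_iter P m f) = teval (gn f) t.
Proof.
have [c ec] : exists c, forall N, gn (inst P (numeral N)) = teval N c.
  apply: (@gn_subst_teval (fun N i => if i is j.+1 then Var j else numeral N)).
  by case=> [|i]; [left|right; exists (Var i)].
elim: m => [|m [t et]]; first by exists (Var 0).
(* [c] gives the effect of one [app] on codes; composing it with [t] adds the outermost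
   application. *)
exists (subst_term (fun=> t) c) => f.
by rewrite /app_iter iterS /app ec -/(app_iter P m f) et teval_comp.
Qed.

(** * Fixed points *)

(* Tarski's form of the diagonal lemma: B is "every y equal to the code of
   theta satisfies theta", whose code is a polynomial in the code of theta. *)
Lemma diagonal_lemma F : closed_at 1 F ->
  exists B, provable PA (Iff B (app F B)).
Proof.
move=> cF.
(* [d] maps the code of [theta (Var 0)] to that of [B] below: 6, 3 and 1 tag [All], [Imp] and [Eq],
   and [tpair (Var 0) (numeral (cpair 0 0))] codes the numeral in the equation. *)
pose d := tpair (numeral 6) (tpair (numeral 3) (tpair
  (tpair (numeral 1) (tpair (numeral (gnt (Var 0)))
                            (tpair (Var 0) (numeral (cpair 0 0))))) (Var 0))).
pose theta u := subst (fun=> subst_term (fun=> u) d) F.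
have theta_subst s u : subst s (theta u) = theta (subst_term s u).
  rewrite /theta subst_comp; apply: eq_subst => i.
  exact: subst_term_comp.
pose N := gn (theta (Var 0)).
pose B := All (Imp (Eq (Var 0) (numeral N)) (theta (Var 0))).
have gnB : gn B = teval N d.
  by rewrite /d !teval_pair !teval_numeral /= /gnt tcode_numeral.
exists B; have := PA_subst_teval N d cF; rewrite -gnB -/(theta (numeral N)).
rewrite -/(app F B) => /provable_iffP[to_app from_app].
apply/provable_iffP; split.
  apply: provable_imp_trans to_app; exists [::]; split=> //; apply: nd_impI.
  have dB : nd [:: B] B by assumption_nd.
  have := nd_allE (numeral N) dB.
  rewrite /inst /= theta_subst subst_numeral /= => h.
  exact: nd_impE h (nd_refl _ _).
apply: (provable_imp_trans from_app); exists [::]; split=> //.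
apply/nd_impI/nd_allI/nd_impI.
have := @nd_leibniz [:: Eq (Var 0) (numeral N); shift (theta (numeral N))]
          (theta (Var 0)) (numeral N) (Var 0).
rewrite /inst !theta_subst /=; apply; first by apply: nd_eq_sym; assumption_nd.
by rewrite /shift theta_subst subst_numeral; assumption_nd.
Qed.

(** The diagonal lemma is applied to the negation of P(t(x)), where [t] computes the code of the
    iterate stripped of its outermost [P]; a positive [m] provides that [P]. *)
Lemma app_iter_fixed_point P m : closed_at 1 P -> 0 < m ->
  exists B, provable PA (Iff B (Neg (app_iter P m B))).
Proof.
case: m => // m cP _; have [t et] := gn_app_iter_teval P m.
pose F := subst (fun=> subst_term (fun=> Var 0) t) P.
have cF : closed_at 1 F.
  by apply: closed_subst => i; apply: term_closed_subst.
have cNF : closed_at 1 (Neg F) by rewrite /= cF.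
have [B /provable_iffP[BF FB]] := diagonal_lemma cNF.
have eF : app (Neg F) B =
    Neg (subst (fun=> subst_term (fun=> numeral (gn B)) t) P).
  rewrite /app /inst /= subst_comp; congr Imp; apply: eq_subst => i /=.
  by rewrite subst_term_comp.
(* By the choice of [t], its value is the code of [app_iter P m B], where [m] is now the predecessor
   of the original exponent. *)
have := PA_subst_teval (gn B) t cP; rewrite -et -/(app P (app_iter P m B)).
rewrite eF in BF FB => /provable_iffP[to_app from_app].
exists B; apply/provable_iffP; split.
  exact: provable_imp_trans BF (provable_contrapose from_app).
exact: provable_imp_trans (provable_contrapose to_app) FB.
Qed.

(** * The second incompleteness theorem *)

Lemma app_iterD P i j f : app_iter P (i + j) f = app_iter P i (app_iter P j f).
Proof. exact: iterD. Qed.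

(** The step from [j] to [j.+1] is D3 for the formula [app_iter P (j * k) f]. *)
Lemma provable_D3_iter S P n k j f : cond_D3 S P n (n + k) ->
  provable S (Imp (app_iter P n f) (app_iter P (n + j * k) f)).
Proof.
move=> D3; elim: j => [|j IH]; first by rewrite addn0; apply: provable_imp_refl.
apply: provable_imp_trans IH _; rewrite mulSn addnA !(app_iterD _ _ (j * k)).
exact: D3.
Qed.

Section Consistency.

Variables (S T : theory) (P : form).
Hypotheses (T_S : extends T S) (P_prov : provability_predicate S T P).
Hypotheses (P_E : cond_E S T P) (P_C : cond_C S P).

Lemma provable_app f : provable T f -> provable T (app P f).
Proof. by move=> /P_prov.2 /T_S. Qed.

Lemma provable_app_iter i f : provable T f -> provable T (app_iter P i f).
Proof. by move=> Tf; elim: i => //= i; apply: provable_app. Qed.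

Hypothesis T_Con : provable T (ConL P).
Hypothesis T_PA : extends T PA.

(** [ConL] speaks of 0 = 1, which must be refuted before E can exchange it with [Bot]. *)
Lemma provable_neg_01 : provable T (Neg (Eq Zero (Succ Zero))).
Proof.
have := T_PA (provable_allE Zero (provable_axiom PA_succ0)).
apply: provable_nd1; apply/nd_impI/(@nd_impE _ (Eq (Succ Zero) Zero)).
  by assumption_nd.
by apply: nd_eq_sym; assumption_nd.
Qed.

(** By E, refutable formulas have equivalent images under []; so [] f implies [] (0 = 1), which
    [ConL] denies. *)
Lemma provable_neg_app f : provable T (Neg f) -> provable T (Neg (app P f)).
Proof.
have app_Bot g : provable T (Neg g) ->
    provable T (Imp (app P g) (app P Bot)) /\
    provable T (Imp (app P Bot) (app P g)).
  by move=> /provable_neg_iff /P_E /T_S /provable_iffP.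
move=> /app_Bot[f_Bot _]; have [_ Bot_01] := app_Bot _ provable_neg_01.
exact: provable_imp_trans (provable_imp_trans f_Bot Bot_01) T_Con.
Qed.

Lemma provable_neg_app_iter i f :
  provable T (Neg f) -> provable T (Neg (app_iter P i f)).
Proof. by move=> Tf; elim: i => //= i; apply: provable_neg_app. Qed.

(** At each step, C turns a refutation of [] (X /\ Y) into one of [] X /\ [] Y, for X and Y the
    iterates reached so far. *)
Lemma provable_neg_app_iter_and i f g : provable T (Neg (And f g)) ->
  provable T (Neg (And (app_iter P i f) (app_iter P i g))).
Proof.
move=> Tfg; elim: i => //= i /provable_neg_app.
exact: provable_imp_trans (T_S (P_C _ _)).
Qed.

End Consistency.

Theorem corollary2p12 (S T : theory) (Pr : form) (n k : nat)
  (S_thy : is_theory S) (T_thy : is_theory T)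
  (S_con : consistent S) (T_con : consistent T)
  (S_ce : ce_theory S) (T_ce : ce_theory T)
  (S_PA : extends S PA) (T_PA : extends T PA)
  (T_S : extends T S)
  (n_ge1 : 1 <= n) (k_ge1 : 1 <= k)
  (Pr_prov : provability_predicate S T Pr) (Pr_Sigma1 : Sigma1 Pr)
  (Pr_E : cond_E S T Pr) (Pr_C : cond_C S Pr)
  (Pr_D3 : cond_D3 S Pr n (n + k)) :
  ~ provable T (ConL Pr).
Proof.
move=> T_Con; pose m := n * k.
have m_gt0 : 0 < m by rewrite muln_gt0 n_ge1.
have [B /T_PA /provable_iffP[B_neg neg_B]] :=
  app_iter_fixed_point Pr_prov.1 m_gt0.
have neg_and : provable T (Neg (And B (app_iter Pr m B))).
  apply: provable_nd1 B_neg; apply: nd_impI.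
  apply: (@nd_impE _ (app_iter Pr m B)).
    by apply: (@nd_impE _ B); [|apply: nd_andE1]; assumption_nd.
  by apply: nd_andE2; assumption_nd.
have neg_n : provable T (Neg (app_iter Pr n B)).
  (* The number of uses of D3 is again [n], so the exponent reached is [n + n * k], that is
     [n + m]. *)
  apply: provable_imp_and (T_S _ (provable_D3_iter n B Pr_D3)) _.
  rewrite app_iterD.
  exact: (provable_neg_app_iter_and T_S Pr_E Pr_C T_Con T_PA n neg_and).
have neg_m : provable T (Neg (app_iter Pr m B)).
  (* As [k] is positive, [m] splits as [(m - n) + n], and the refutation passes through the outer
     [m - n] applications. *)
  rewrite -[m](subnK (leq_pmulr n k_ge1)) app_iterD.
  exact: (provable_neg_app_iter T_S Pr_E T_Con T_PA _ neg_n).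
apply: T_con; apply: (provable_impE neg_m).
exact: (provable_app_iter T_S Pr_prov m (provable_impE neg_B neg_m)).
Qed.
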